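(* Let $(X,d)$ be a nonempty separable metric space in which all balls $D(x,r):=\{y: d(x,y)<r\}$ are relatively compact, let $\mu$ be a positive Radon measure on $X$ with full support, and let $(x,y,t)\mapsto p_t(x,y)\in[0,\infty)$ be a continuous function on $X\times X\times(0,\infty)$ such that: (CK) $p_{s+t}(x,y)=\int p_s(x,z)p_t(z,y)\,d\mu(z)$ for all $s,t>0$, $x,y\in X$; (E) $\sup_{t>0}\int p_t(x,y)\,d\mu(y)=1$ for every $x\in X$; (B) there are constants $\alpha,\beta>0$ and decreasing functions $\Phi_1,\Phi_2\colon[0,\infty)\to[0,\infty)$ with $\Phi_1(1)>0$, $\int_0^\infty\sigma^{\alpha-1}\Phi_2(\sigma)\,d\sigma<\infty$ and $$t^{-\alpha/\beta}\Phi_1\big(d(x,y)t^{-1/\beta}\big)\le p_t(x,y)\le t^{-\alpha/\beta}\Phi_2\big(d(x,y)t^{-1/\beta}\big)\quad\text{for all }x,y\in X,\ t>0.$$ Let $X':=X\times\mathbb R$. Then there exists $\kappa>0$ such that, for all $x'\in X'$ and $\rho>0$, there is a point $z'\in X'$ with $$Z_\beta\big(x',(\kappa\rho)^{1/\alpha}\big)\subset B(z',\rho).$$ In particular, $\kappa\,m_{G'}\le m_{\alpha,\beta}$.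
   Context: $G'\colon X'\times X'\to[0,\infty)$ is given by $G'((x,r),(y,s)):=p_{r-s}(x,y)$ if $r>s$ and $:=0$ if $r\le s$. $B(x',\rho):=\{y'\in X': G'(x',y')>1/\rho\}$ and, for $A\subset X'$, $$m_{G'}(A):=\lim_{\delta\to0}\inf\Big\{\sum_{j=1}^\infty\rho_j:\ A\subset\bigcup_{j=1}^\infty B(x_j',\rho_j),\ x_j'\in X',\ 0<\rho_j<\delta\Big\}.$$ $Z_\beta((x,r),\rho):=\{(y,s)\in X': d(x,y)<\rho\text{ and }|r-s|<\rho^\beta\}$ and, for $A\subset X'$, $$m_{\alpha,\beta}(A):=\lim_{\delta\to0}\inf\Big\{\sum_{j=1}^\infty\rho_j^\alpha:\ A\subset\bigcup_{j=1}^\infty Z_\beta(x_j',\rho_j),\ x_j'\in X',\ 0<\rho_j<\delta\Big\}.$$ *)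

(* Defs.v *)
From HB Require Import structures.
From mathcomp Require Import all_boot all_order all_algebra.
From mathcomp Require Import all_classical all_reals all_analysis.
Set Implicit Arguments.
Unset Strict Implicit.
Unset Printing Implicit Defensive.
Import Order.TTheory GRing.Theory Num.Theory.
Import numFieldNormedType.Exports.
Local Open Scope classical_set_scope.
Local Open Scope ring_scope.

(* A nonempty metric space: [measurableType], hence the Borel sigma-algebra
   below, requires a pointed carrier. *)
#[short(type="pMetricType")]
HB.structure Definition PointedMetric (R : numDomainType) :=
  {X of Metric R X & PseudoPointedMetric R X}.

Notation borelType X := (g_sigma_algebraType (@open X)).

Definition separable (T : topologicalType) :=
  exists2 D : set T, countable D & dense D.

(* Radon measures on a locally compact Hausdorff space, as in Riesz'
   representation theorem. *)
Definition radon_measure (R : realType) (X : pMetricType R)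
    (mu : {measure set (borelType X) -> \bar R}) : Prop :=
  [/\ forall K : set X, compact K -> (mu K < +oo)%E,
      forall A : set (borelType X), measurable A ->
        mu A = ereal_inf [set mu U | U in [set U : set X | open U /\ A `<=` U]]
    & forall U : set X, open U ->
        mu U =
        ereal_sup [set mu K | K in [set K : set X | compact K /\ K `<=` U]]].

Definition measure_support (R : realType) (X : pMetricType R)
    (mu : {measure set (borelType X) -> \bar R}) : set X :=
  [set x | forall U : set X, open U -> U x -> (0 < mu U)%E].

(* For a gauge [w] and a family of sets [D x rho], the limit as delta -> 0+ of
   inf { sum_j w(rho_j) : A covered by the D(x_j, rho_j), 0 < rho_j < delta }. *)
Definition covering_measure (R : realType) (S : Type)
    (D : S -> R -> set S) (w : R -> R) (A : set S) : \bar R :=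
  lim ((fun delta : R =>
    ereal_inf [set e : \bar R | exists x : nat -> S, exists rho : nat -> R,
      [/\ forall j, 0 < rho j < delta,
          A `<=` \bigcup_j D (x j) (rho j)
        & e = (\sum_(0 <= j <oo) (w (rho j))%:E)%E]]) @ 0^'+).

Section spacetime.
Context (R : realType) (X : pMetricType R).

Definition spacetime : Type := (X * R)%type.

Variable p : R -> X -> X -> R.

Definition G' (x' y' : spacetime) : R :=
  if y'.2 < x'.2 then p (x'.2 - y'.2) x'.1 y'.1 else 0.

Definition B (x' : spacetime) (rho : R) : set spacetime :=
  [set y' | 1 / rho < G' x' y'].

Definition m_G' (A : set spacetime) : \bar R :=
  covering_measure B (fun rho => rho) A.

Definition Z (beta : R) (x' : spacetime) (rho : R) : set spacetime :=
  [set y' | mdist x'.1 y'.1 < rho /\ `|x'.2 - y'.2| < rho `^ beta].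

Definition m_ (alpha beta : R) (A : set spacetime) : \bar R :=
  covering_measure (Z beta) (fun rho => rho `^ alpha) A.

End spacetime.

(* Main.v *)
(* A parabolic cylinder of radius r centred at (x, s) lies in the G'-ball centred
   at (x, s + 2 r^beta): seen from there, its points lie back in time by
   t in (r^beta, 3 r^beta), so t^(1/beta) exceeds the spatial distance and the
   lower bound on p_t is at least (3 r^beta)^(-alpha/beta) Phi1(1), a constant
   times r^(-alpha). Covers by cylinders thus turn into covers by G'-balls with
   comparable weights. *)

Require Import Defs.
From mathcomp Require Import all_boot all_order all_algebra.
From mathcomp Require Import all_classical all_reals all_analysis.
From mathcomp Require Import lra.
Set Implicit Arguments.
Unset Strict Implicit.
Unset Printing Implicit Defensive.
Import Order.TTheory GRing.Theory Num.Theory.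
Import numFieldNormedType.Exports.
Local Open Scope classical_set_scope.
Local Open Scope ring_scope.

(** A smaller [delta] admits fewer covers, so the infimum grows as [delta] decreases to 0 and its
    right limit is a supremum. *)
Lemma covering_measure_sup (R : realType) (S : Type) (D : S -> R -> set S)
    (w : R -> R) (A : set S) :
  covering_measure D w A =
  ereal_sup [set ereal_inf [set e : \bar R | exists x : nat -> S,
      exists rho : nat -> R,
      [/\ forall j, 0 < rho j < delta,
          A `<=` \bigcup_j D (x j) (rho j)
        & e = (\sum_(0 <= j <oo) (w (rho j))%:E)%E]] |
    delta in [set delta | 0 < delta]].
Proof.
have -> : [set delta : R | 0 < delta] = [set` `]0, +oo[].
  by apply/seteqP; split => d /=; rewrite in_itv/= andbT.
apply/cvg_lim => //; apply: nonincreasing_at_right_cvge => //.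
move=> d1 d2 _ _ d12; apply: ereal_inf_le_tmp => e [x [rho [rho_lt AD ->]]].
exists x, rho; split => // j; have /andP[-> rho_d1] := rho_lt j.
exact: lt_le_trans rho_d1 d12.
Qed.

(** Covers are transported term by term: [h] converts a [D]-radius into a [D']-radius, keeps the
    mesh small and scales the weight by exactly [kappa]. *)
Lemma le_covering_measure (R : realType) (S : Type) (D D' : S -> R -> set S)
    (w w' h : R -> R) (kappa : R) (A : set S) :
    0 < kappa ->
    (forall r, 0 < r -> 0 < h r /\ 0 <= w' (h r)) ->
    (forall delta, 0 < delta ->
      exists2 d, 0 < d & forall r, 0 < r < d -> h r < delta) ->
    (forall x r, 0 < r -> exists z, D x r `<=` D' z (h r)) ->
    (forall r, 0 < r -> kappa * w' (h r) = w r) ->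
  (kappa%:E * covering_measure D' w' A <= covering_measure D w A)%E.
Proof.
move=> kappa0 h_gt0 h_small DD' ww'.
(* Moving [kappa] to the right isolates the supremum, so that each mesh [delta] can be treated
   separately. *)
rewrite -lee_pdivlMl// !covering_measure_sup.
apply: ge_ereal_sup => _ [delta /= delta0 <-].
rewrite lee_pdivlMl//; have [d d0 h_lt] := h_small _ delta0.
apply: le_ereal_sup_tmp; eexists; first by exists d.
apply: le_ereal_inf_tmp => _ [x [rho [rho_d AD ->]]].
have rho0 j : 0 < rho j by case/andP: (rho_d j).
have /choice[z Dz] j : exists z, D (x j) (rho j) `<=` D' z (h (rho j)).
  exact: DD'.
have -> : (\sum_(0 <= j <oo) (w (rho j))%:E =
    kappa%:E * \sum_(0 <= j <oo) (w' (h (rho j)))%:E)%E.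
  rewrite -nneseriesZl; last by move=> j _; rewrite lee_fin (h_gt0 _ _).2.
  by apply: eq_eseriesr => j _; rewrite -EFinM ww'.
rewrite lee_pmul2l//; apply: ereal_inf_lbound.
exists z, (h \o rho); split => // [j|y /AD[j _ yD]].
  by rewrite /= (h_gt0 _ _).1//= h_lt.
by exists j => //; exact: Dz.
Qed.

Lemma Z_sub_B (R : realType) (X : pMetricType R) (p : R -> X -> X -> R)
    (alpha beta c : R) (x' : spacetime X) (r : R) :
    0 < alpha -> 0 < beta -> 0 < c ->
    (forall (x y : X) (t : R), 0 < t -> mdist x y * t `^ (- (1 / beta)) <= 1 ->
      t `^ (- (alpha / beta)) * c <= p t x y) ->
    0 < r ->
  Z beta x' r `<=`
  B p (x'.1, x'.2 + 2 * r `^ beta) (r `^ alpha / (3 `^ (- (alpha / beta)) * c)).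
Proof.
move=> alpha0 beta0 c0 p_ge r0 [y s] [/= dxy]; rewrite ltr_norml => /andP[lo hi].
have rb0 : 0 < r `^ beta by rewrite powR_gt0.
rewrite /B /G' /=; set t := _ + _ - s.
have [t_gt t_lt] : r `^ beta < t /\ t < 3 * r `^ beta by rewrite /t; split; lra.
have t0 : 0 < t by exact: lt_trans t_gt.
rewrite ifT; last by rewrite -subr_gt0.
apply: (lt_le_trans _ (p_ge _ _ _ t0 _)); last first.
  rewrite div1r powRN ler_pdivrMr ?powR_gt0// mul1r (le_trans (ltW dxy))//.
  have -> : r = (r `^ beta) `^ beta^-1.
    by rewrite -powRrM mulfV ?gt_eqF// powRr1// ltW.
  by apply: ge0_ler_powR; rewrite ?nnegrE ?invr_ge0 ltW.
rewrite div1r invf_div mulrAC ltr_pM2r//.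
have -> : r `^ alpha = (r `^ beta) `^ (alpha / beta).
  by rewrite -powRrM mulrCA mulfV ?gt_eqF// mulr1.
rewrite !powRN -invfM -powRM ?ltW// ltf_pV2 ?posrE ?powR_gt0 ?mulr_gt0//.
by apply: gt0_ltr_powR; rewrite ?nnegrE ?divr_gt0 ?mulr_ge0// ltW.
Qed.

Theorem proposition7p7 (R : realType) (X : pMetricType R)
    (mu : {measure set (borelType X) -> \bar R})
    (p : R -> X -> X -> R) (alpha beta : R) (Phi1 Phi2 : R -> R)
  (X_separable : separable X)
  (X_balls : forall (x : X) (r : R),
    precompact [set y : X | mdist x y < r])
  (mu_radon : radon_measure mu)
  (mu_full : measure_support mu = [set: X])
  (p_ge0 : forall (t : R) (x y : X), 0 < t -> 0 <= p t x y)
  (p_continuous : {within [set q : X * X * R | 0 < q.2],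
    continuous (fun q : X * X * R => p q.2 q.1.1 q.1.2)})
  (CK : forall (s t : R) (x y : X), 0 < s -> 0 < t ->
    (p (s + t) x y)%:E = (\int[mu]_z (p s x z * p t z y)%:E)%E)
  (E : forall x : X,
    ereal_sup [set (\int[mu]_y (p t x y)%:E)%E | t in [set t : R | 0 < t]]
    = 1%E)
  (alpha_gt0 : 0 < alpha) (beta_gt0 : 0 < beta)
  (Phi1_ge0 : forall s : R, 0 <= s -> 0 <= Phi1 s)
  (Phi2_ge0 : forall s : R, 0 <= s -> 0 <= Phi2 s)
  (Phi1_decr : forall s t : R, 0 <= s -> s <= t -> Phi1 t <= Phi1 s)
  (Phi2_decr : forall s t : R, 0 <= s -> s <= t -> Phi2 t <= Phi2 s)
  (Phi1_1 : 0 < Phi1 1)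
  (Phi2_int : (\int[lebesgue_measure]_(s in `]0%R, +oo[)
    (s `^ (alpha - 1) * Phi2 s)%:E < +oo)%E)
  (bounds : forall (x y : X) (t : R), 0 < t ->
    t `^ (- (alpha / beta)) * Phi1 (mdist x y * t `^ (- (1 / beta)))
      <= p t x y
      <= t `^ (- (alpha / beta)) * Phi2 (mdist x y * t `^ (- (1 / beta)))) :
  exists kappa : R,
    [/\ 0 < kappa,
        forall (x' : spacetime X) (rho : R), 0 < rho ->
          exists z' : spacetime X,
            Z beta x' ((kappa * rho) `^ (1 / alpha)) `<=` B p z' rho
      & forall A : set (spacetime X),
          (kappa%:E * m_G' p A <= m_ alpha beta A)%E].
Proof.
set kappa := 3 `^ (- (alpha / beta)) * Phi1 1.
have kappa0 : 0 < kappa by rewrite mulr_gt0 ?powR_gt0.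
have ZB (x' : spacetime X) (r : R) : 0 < r ->
    exists z', Z beta x' r `<=` B p z' (r `^ alpha / kappa).
  move=> r0; eexists; apply: Z_sub_B => // x y t t0 dt.
  (* The scaled distance lies in [0, 1], where the decreasing [Phi1] is at least [Phi1 1]. *)
  have /andP[+ _] := bounds x y t t0; apply: le_trans.
  rewrite ler_pM2l ?powR_gt0//; apply: Phi1_decr => //.
  by rewrite mulr_ge0 ?powR_ge0 ?mdist_ge0.
have radiusK (rho : R) : 0 < rho ->
    ((kappa * rho) `^ (1 / alpha)) `^ alpha / kappa = rho.
  move=> rho0; rewrite -powRrM mul1r mulVf ?gt_eqF// powRr1; last first.
    by rewrite mulr_ge0 ?ltW.
  by rewrite mulrAC mulfV ?gt_eqF// mul1r.
exists kappa; split => // [x' rho rho0|A].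
  have [|z' Zz'] := ZB x' ((kappa * rho) `^ (1 / alpha)).
    by rewrite powR_gt0 ?mulr_gt0.
  by exists z'; rewrite -[X in B p z' X]radiusK.
apply: (le_covering_measure (h := fun r => r `^ alpha / kappa)) => //.
- by move=> r r0; rewrite divr_ge0 ?divr_gt0 ?powR_gt0// ?powR_ge0// ltW.
(* The threshold is the cylinder radius that [h] sends to [delta]; [h] is increasing. *)
- move=> delta delta0; exists ((kappa * delta) `^ (1 / alpha)).
    by rewrite powR_gt0 ?mulr_gt0.
  move=> r /andP[r0 rd]; rewrite -[ltRHS]radiusK// ltr_pM2r ?invr_gt0//.
  by apply: gt0_ltr_powR => //; rewrite nnegrE ?powR_ge0// ltW.
- by move=> r r0; rewrite mulrC divfK// gt_eqF.
Qed.
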